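(* Let $\delta\in\mathbb{R}$ be fixed. Let $0<\beta<mn$, $\tilde\delta\in\mathbb{R}$, let $\vec{p}=(p_1,\dots,p_m)$ be a vector of exponents with $1/p=\sum_{i=1}^m1/p_i$, and let $(w,\vec v)$, $\vec v=(v_1,\dots,v_m)$, be a pair of weights. The following statements hold: (a) If $\tilde\delta>\delta$ or $\tilde\delta>\beta-n/p$, then condition $(w,\vec v)\in\mathbb{H}_m(\vec{p},\beta,\tilde\delta)$ is satisfied if and only if $v_i=\infty$ a.e. for some $1\le i\le m$. (b) If $\tilde\delta=\beta-n/p=\delta$, then condition $(w,\vec v)\in\mathbb{H}_m(\vec{p},\beta,\tilde\delta)$ is satisfied if and only if $v_i=\infty$ a.e. for some $1\le i\le m$. (c) If $\tilde\delta<\beta-mn$, then condition $(w,\vec v)\in\mathbb{H}_m(\vec{p},\beta,\tilde\delta)$ is satisfied if and only if $v_i=\infty$ a.e. for some $1\le i\le m$ or $w=0$ a.e.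
   Context: $m,n\in\mathbb{N}$; the underlying space is $\mathbb{R}^n$. A weight is any positive and locally integrable function. $\mathcal{X}_B$ is the characteristic function of $B$. A vector of exponents is $\vec{p}=(p_1,\dots,p_m)$ with $1\le p_i\le\infty$ for every $i$; $p_i'$ is the conjugate exponent of $p_i$. With $\delta\in\mathbb{R}$ fixed, and with fixed numbers $\beta_i$ satisfying $0<\beta_i<n$ for every $i$ and $\sum_{i=1}^m\beta_i=\beta$, we say that $(w,\vec{v})\in\mathbb{H}_m(\vec{p},\beta,\tilde\delta)$ if there is $C>0$ such that for every ball $B=B(x_B,R)$ $$\frac{\|w\mathcal{X}_B\|_\infty}{|B|^{(\tilde\delta-\delta)/n}}\prod_{i=1}^m\left(\int_{\mathbb{R}^n}\frac{v_i^{-p_i'}(y)}{(|B|^{1/n}+|x_B-y|)^{(n-\beta_i+\delta/m)p_i'}}\,dy\right)^{1/p_i'}\le C,$$ where for $p_i=1$ the $i$-th factor is understood as $\left\|\frac{v_i^{-1}}{(|B|^{1/n}+|x_B-\cdot|)^{n-\beta_i+\delta/m}}\right\|_\infty$.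
   Formalization: In (b) the case where all p_i=1 and all β_i=n+δ/m is excluded: there w=v_1=…=v_m=1 satisfies the condition, so (b) as stated fails. Each v_i is a weight or ∞ a.e.; w is a weight, or in (c) possibly 0 a.e. *)

(* Defs.v *)
From HB Require Import structures.
From mathcomp Require Import all_boot all_order all_algebra.
From mathcomp Require Import all_classical all_reals all_analysis.
From mathcomp Require Import measurable_realfun ess_sup_inf.
Set Implicit Arguments.
Unset Strict Implicit.
Unset Printing Implicit Defensive.
Import Order.TTheory GRing.Theory Num.Theory.
Import numFieldNormedType.Exports.
Local Open Scope classical_set_scope.
Local Open Scope ring_scope.

(* The points of R^n are n-tuples, whose canonical sigma-algebra is the one
   generated by the coordinates, i.e. the Borel sigma-algebra of R^n. *)
Notation euclid R n := (n.-tuple (measurableTypeR R)).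

Section cons_measure.
Context (R : realType) (n : nat).
Variable mu : {sigma_finite_measure set (euclid R n) -> \bar R}.

Let R1 := measurableTypeR R.

Definition tcons (z : R1 * euclid R n) : euclid R n.+1 := [tuple of z.1 :: z.2].

Lemma measurable_tcons : measurable_fun [set: R1 * euclid R n] tcons.
Proof. exact: (measurable_cons measurable_fst measurable_snd). Qed.

Definition cons_measure : set (euclid R n.+1) -> \bar R :=
  pushforward (@lebesgue_measure R \x mu)%E tcons.

Let cons_measure0 : cons_measure set0 = 0%E.
Proof. by rewrite /cons_measure /pushforward preimage_set0 measure0. Qed.

Let cons_measure_ge0 A : (0 <= cons_measure A)%E.
Proof. by apply: integral_ge0 => x _ /=; exact: measure_ge0. Qed.

Let cons_measure_sigma_additive : semi_sigma_additive cons_measure.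
Proof.
move=> F mF tF mUF; rewrite /cons_measure /pushforward preimage_bigcup.
apply: measure_semi_sigma_additive.
- by move=> k; rewrite -[X in measurable X]setTI; exact: measurable_tcons.
- apply/trivIsetP => /= i j _ _ ij; rewrite -preimage_setI.
  by move/trivIsetP : tF => /(_ _ _ _ _ ij) -> //; rewrite preimage_set0.
- rewrite -preimage_bigcup -[X in measurable X]setTI.
  exact: measurable_tcons.
Qed.

HB.instance Definition _ := isMeasure.Build _ _ _ cons_measure
  cons_measure0 cons_measure_ge0 cons_measure_sigma_additive.

Let cons_sigma_finite : sigma_finite setT cons_measure.
Proof.
have /sigma_finiteP[F [TF ndF Foo]] := sigma_finiteT (@lebesgue_measure R).
have /sigma_finiteP[G [TG ndG Goo]] := sigma_finiteT mu.
pose g (x : euclid R n.+1) : R1 * euclid R n := (thead x, [tuple of behead x]).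
have mg : measurable_fun [set: euclid R n.+1] g.
  apply/measurable_fun_pairP; split => /=; last exact: measurable_behead.
  exact: (measurable_tnth ord0).
have gK z : g (tcons z) = z.
  by case: z => x t; rewrite /g/= theadE; congr pair; apply/val_inj.
exists (fun k => g @^-1` (F k `*` G k)).
  rewrite -preimage_bigcup (_ : \bigcup_k _ = setT) ?preimage_setT//.
  apply/seteqP; split => // -[x y] _.
  have [k _ Fx] : (\bigcup_k F k) x by rewrite -TF.
  have [l _ Gy] : (\bigcup_k G k) y by rewrite -TG.
  exists (maxn k l) => //; split => /=.
  - by move: Fx; apply/subsetPset/ndF/leq_maxl.
  - by move: Gy; apply/subsetPset/ndG/leq_maxr.
move=> k; have [mF Fk] := Foo k; have [mG Gk] := Goo k.
split; first by rewrite -[X in measurable X]setTI; apply: mg => //; exact: measurableX.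
rewrite /cons_measure /pushforward/= (_ : tcons @^-1` _ = F k `*` G k).
  by rewrite product_measure1E// lte_mul_pinfty// ge0_fin_numE.
by rewrite -comp_preimage (_ : g \o tcons = id) ?preimage_id//; exact/funext.
Qed.

HB.instance Definition _ :=
  Measure_isSigmaFinite.Build _ _ _ cons_measure cons_sigma_finite.

End cons_measure.

Fixpoint lebesgue_n (R : realType) (n : nat) :
    {sigma_finite_measure set (euclid R n) -> \bar R} :=
  match n with
  | 0 => \d_([tuple] : euclid R 0)
  | n'.+1 => cons_measure (lebesgue_n R n')
  end.

Lemma lebesgue_n_box (R : realType) (n : nat) (A : 'I_n -> set (measurableTypeR R)) :
  (forall i, measurable (A i)) ->
  lebesgue_n R n [set x | forall i, A i (tnth x i)] =
  (\prod_(i < n) lebesgue_measure (A i))%E.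
Proof.
elim: n => [|n IHn] in A * => mA.
  by rewrite big_ord0 /= diracE mem_set//; case.
rewrite big_ord_recl -(IHn (fun i => A (lift ord0 i)))// -product_measure1E//=.
  rewrite /cons_measure /pushforward (_ : @tcons R n @^-1` _ =
    A ord0 `*` [set t | forall i, A (lift ord0 i) (tnth t i)])//.
  apply/seteqP; split => -[x t] /=.
  - move=> h; split; first exact: (h ord0).
    move=> i; have := h (lift ord0 i); rewrite tnthS.
    by congr (A _ (tnth _ _)); apply/val_inj.
  - move=> [Ax At] i; case: (unliftP ord0 i) => [j ->|-> //].
    by rewrite tnthS; have := At j; congr (A _ (tnth _ _)); apply/val_inj.
rewrite (_ : [set _ | _] =
    \bigcap_(i in [set: 'I_n]) ((fun x => tnth x i) @^-1` A (lift ord0 i))).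
  apply: fin_bigcap_measurable => // i _; rewrite -[X in measurable X]setTI.
  exact: (@measurable_tnth _ (measurableTypeR R) n i).
by apply/seteqP; split => x /= h i; [move=> _; exact: h|exact: h].
Qed.

Section two_weights.
Context (R : realType) (n : nat).
Implicit Types (x y : euclid R n) (r : R).
Local Notation mu := (lebesgue_n R n).

Definition eucl_dist x y : R :=
  Num.sqrt (\sum_(i < n) ((tnth x i : R) - (tnth y i : R)) ^+ 2).

Definition eucl_ball x r : set (euclid R n) := [set y | eucl_dist x y < r].

Definition volume (B : set (euclid R n)) : R := fine (mu B).

Definition weight (f : euclid R n -> \bar R) : Prop :=
  [/\ measurable_fun [set: euclid R n] f, (forall x, 0 < f x)%E &
     forall x r, (\int[mu]_(y in eucl_ball x r) f y < +oo)%E].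

(* A function equal to +oo a.e. is not locally integrable, and one equal to 0
   a.e. is not positive, so neither is a weight. They are the degenerate
   entries which a pair of weights is allowed to have. *)
Definition degenerate_weight (c : \bar R) (f : euclid R n -> \bar R) : Prop :=
  [/\ measurable_fun [set: euclid R n] f, (forall x, 0 <= f x)%E &
     {ae mu, forall x, f x = c}].

(* At p = 1 the conjugate exponent is +oo and the norm is the L^oo norm; for
   p > 1 the norm unfolds to the integral of
   v^-p' / (|B|^(1/n) + |xB - y|)^((n - b + delta/m)p'), raised to 1/p'.
   The inverse of v is taken in \bar R, where (+oo)^-1 = 0. *)
Definition H_factor (m : nat) (delta : R) (p : \bar R) (b : R)
    (v : euclid R n -> \bar R) (xB : euclid R n) (B : set (euclid R n)) : \bar R :=
  Lnorm mu (hoelder_conjugate p) (fun y =>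
    (v y)^-1 / ((volume B `^ n%:R^-1 + eucl_dist xB y)
                  `^ (n%:R - b + delta / m%:R))%R%:E)%E.

(* Products in \bar R follow the convention 0 * +oo = 0. *)
Definition H_class (m : nat) (delta : R) (p : 'I_m -> \bar R) (b : 'I_m -> R)
    (delta' : R) (w : euclid R n -> \bar R) (v : 'I_m -> euclid R n -> \bar R) :
    Prop :=
  exists2 C : R, 0 < C & forall xB r, 0 < r -> let B := eucl_ball xB r in
    (Lnorm mu +oo (fun x => w x * (\1_B x)%:E)
       / (volume B `^ ((delta' - delta) / n%:R))%R%:E
       * \prod_(i < m) H_factor m delta (p i) (b i) (v i) xB B <= C%:E)%E.

End two_weights.

(* Main.v *)
Require Import Defs.
From HB Require Import structures.
From mathcomp Require Import all_boot all_order all_algebra.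
From mathcomp Require Import all_classical all_reals all_analysis.
From mathcomp Require Import measurable_realfun ess_sup_inf.
From mathcomp Require Import ring lra.
Set Implicit Arguments.
Unset Strict Implicit.
Unset Printing Implicit Defensive.
Import Order.TTheory GRing.Theory Num.Theory.
Local Open Scope classical_set_scope.
Local Open Scope ring_scope.

(** Only "condition implies degeneracy" needs an argument. If no v_i is infinite a.e.
    and w is not 0 a.e., then w and all v_i are weights, and for some k the set E of the points of a
    ball where w >= 1/k and all v_i <= k has positive measure. Keeping the richest
    half-size subcube again and again yields a point x with |E /\ B(x,r)| >= t r^n
    for all small r. Write rho = |B(x,r)|^(1/n), which is comparable to r, and
    a_i = n - b_i + delta/m. Restricting the i-th norm to parts of E bounds it below,
    up to a constant, by 1 and by rho^(n/p_i' - a_i) as r -> 0, and by rho^(-a_i)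
    as r -> oo. Letting r -> 0 in the condition at x excludes (a), letting r -> oo
    excludes (c). In (b) the exponents n/p_i' - a_i add up to 0: either one of them
    is negative and the corresponding factor blows up as r -> 0, or they all vanish
    and the factor with p_i <> 1 diverges logarithmically. *)

(** * Norms and conjugate exponents *)

Import HBNNSimple.

Section conjugate_exponent.
Context (R : realType).
Implicit Types p : \bar R.

Lemma inve_fineK p : (1 <= p)%E -> p^-1%E = (fine p^-1)%:E.
Proof.
by case: p => [r| |]//; rewrite lee_fin => r1; rewrite inver gt_eqF// (lt_le_trans _ r1).
Qed.

Lemma fine_inve_itv p : (1 <= p)%E -> 0 <= fine p^-1 <= 1.
Proof.
case: p => [r| |]//; last by rewrite invey/= lexx ler01.
rewrite lee_fin => r1; have r0 : 0 < r by rewrite (lt_le_trans _ r1).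
by rewrite inver gt_eqF//= invr_ge0 (ltW r0) invf_le1.
Qed.

(** Expressing the conjugate exponent through 1/p treats p = +oo together with the finite exponents.
    Only p = 1 stays apart, its conjugate being +oo. *)
Lemma hoelder_conjugateE p : (1 <= p)%E -> p != 1%E ->
  0 < 1 - fine p^-1 /\ hoelder_conjugate p = ((1 - fine p^-1)^-1)%:E.
Proof.
case: p => [r| |]//; last first.
  by move=> _ _; rewrite hoelder_conjugatey invey/= subr0 invr1; split => //; exact: ltr01.
rewrite lee_fin eqe => r1 rN1; have r0 : 0 < r by rewrite (lt_le_trans _ r1).
have r1' : 1 < r by rewrite lt_neqAle eq_sym rN1.
rewrite /hoelder_conjugate /= eqe gt_eqF// inver gt_eqF//= -EFinD inver subr_eq0 (negbTE rN1).
split; first by rewrite subr_gt0 invf_lt1.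
rewrite -EFinM; congr EFin.
have ? : r - 1 != 0 by rewrite subr_eq0.
have ? : r != 0 by rewrite gt_eqF.
by field; apply/andP.
Qed.

End conjugate_exponent.

Section measure_lemmas.
Context d (T : measurableType d) (R : realType).
Variable mu : {measure set T -> \bar R}.
Implicit Types (f g : T -> \bar R) (S : set T) (c : R).

(* Unlike in [ge0_le_integral], no measurability is needed. *)
Lemma le_integral_ge0 f g : (forall x, 0 <= f x)%E ->
  (forall x, f x <= g x)%E -> (\int[mu]_x f x <= \int[mu]_x g x)%E.
Proof.
move=> f0 fg; have g0 x : (0 <= g x)%E by exact: le_trans (f0 x) (fg x).
rewrite !ge0_integralTE//; apply: le_ereal_sup => _ [h /= hf <-].
by exists h => //= x; exact: le_trans (hf x) (fg x).
Qed.

(** No measurability of [f] is assumed: the integral is the supremum over simple functions below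
    [f], and each of these vanishes a.e. *)
Lemma integral_ge0_ae0 f : (forall x, 0 <= f x)%E ->
  {ae mu, forall x, f x = 0%E} -> (\int[mu]_x f x)%E = 0%E.
Proof.
move=> f0 fae; apply/eqP; rewrite eq_le integral_ge0// andbT.
rewrite ge0_integralTE//; apply: ge_ereal_sup => _ [h /= hf <-].
rewrite -integralT_nnsfun (@ae_eq_integral _ _ _ _ _ (cst 0%E))//.
- by rewrite integral0.
- exact/measurable_EFinP.
- apply: filterS fae => x fx0 _ /=; apply/eqP; rewrite eq_le [X in _ && X]lee_fin fun_ge0 andbT.
  by have := hf x; rewrite fx0.
Qed.

Lemma measure_le_sum_cover (I : finType) (F : I -> set T) S :
  measurable S -> (forall i, measurable (F i)) -> S `<=` \bigcup_i F i ->
  (mu S <= \sum_i mu (F i))%E.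
Proof.
move=> mS mF SF.
have mB s : measurable (\big[setU/set0]_(i <- s) F i).
  exact: bigsetU_measurable.
apply: (@le_trans _ _ (mu (\big[setU/set0]_i F i))).
  apply: le_measure; rewrite ?inE//.
  by move=> x /SF[i _ Fix]; rewrite (bigD1 i)//=; left.
elim: (index_enum I) => [|i s IH]; first by rewrite !big_nil measure0.
by rewrite !big_cons (le_trans (measureU2 _ _ _))// leeD2l.
Qed.

Lemma ess_sup_ge_on S f (c : \bar R) : measurable S -> (0 < mu S)%E ->
  (forall x, S x -> c <= f x)%E -> (c <= ess_sup mu f)%E.
Proof.
move=> mS S0 cf; rewrite leNgt; apply/negP => fc.
have /negligibleP : mu.-negligible S.
  apply: negligibleS (ess_sup_ge mu f) => x Sx /= /(le_lt_trans)/(_ fc).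
  by rewrite ltNge cf.
by move=> /(_ mS) S0'; rewrite S0' ltxx in S0.
Qed.

(** A Chebyshev-type bound. The exponent 1 - 1/p is 1/p', and at p = 1 it is 0, so that one formula
    covers the essential supremum as well. *)
Lemma Lnorm_conjugate_ge (p : \bar R) f S c :
  (1 <= p)%E -> measurable S -> (0 < mu S < +oo)%E -> 0 <= c ->
  (forall x, S x -> c%:E <= `|f x|)%E ->
  ((c * fine (mu S) `^ (1 - fine p^-1))%:E <= Lnorm mu (hoelder_conjugate p) f)%E.
Proof.
move=> p1 mS /andP[S0 Sfin] c0 cf; have [->|pN1] := eqVneq p 1%E.
  rewrite hoelder_conjugate1 inve1 /= subrr powRr0 mulr1 unlock.
  (* The L^oo norm is set to 0 when the whole space is null; the set [S] excludes this. *)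
  have -> : (0 < mu [set: T])%E.
    by apply: (lt_le_trans S0); apply: le_measure; rewrite ?inE.
  exact: (@ess_sup_ge_on S).
have [q0 ->] := hoelder_conjugateE p1 pN1; rewrite unlock invrK.
set q := (1 - fine _)^-1; have {}q0 : 0 < q by rewrite invr_gt0.
have -> : 1 - fine p^-1 = q^-1 by rewrite invrK.
clearbody q.
set I := (X in (_ <= X `^ _)%E).
have cI : ((c `^ q * fine (mu S))%:E <= I)%E.
  rewrite EFinM fineK ?ge0_fin_numE// -integral_cst//= integral_mkcond.
  apply: le_integral_ge0 => x; rewrite /patch.
    by case: ifPn => //= _; rewrite lee_fin powR_ge0.
  case: ifPn => [|_]; last exact: poweR_ge0.
  rewrite inE => Sx /=; rewrite -poweR_EFin.
  by apply: gt0_ler_poweR; rewrite ?(ltW q0)// ?in_itv/= ?lee_fin ?leey ?cf ?c0 ?abse_ge0.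
apply: (@le_trans _ _ ((c `^ q * fine (mu S))%:E `^ q^-1)%E); last first.
  apply: gt0_ler_poweR => //; rewrite ?invr_ge0 ?(ltW q0)// in_itv/= ?leey ?andbT.
    by rewrite lee_fin mulr_ge0// ?powR_ge0// fine_ge0.
  by apply: le_trans cI; rewrite lee_fin mulr_ge0// ?powR_ge0// fine_ge0.
rewrite poweR_EFin lee_fin powRM ?powR_ge0 ?fine_ge0//.
by rewrite -powRrM mulfV ?gt_eqF// powRr1.
Qed.

Lemma Lnorm_ae0 (p : \bar R) f : (1 <= p)%E -> {ae mu, forall x, f x = 0%E} ->
  Lnorm mu p f = 0%E.
Proof.
move=> p1 f0; rewrite unlock; case: p p1 => [r|_|//].
- rewrite lee_fin => r1; have r0 : r != 0 by rewrite gt_eqF// (lt_le_trans _ r1).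
  rewrite integral_ge0_ae0.
  + by rewrite poweR0r// invr_eq0.
  + by move=> x; exact: poweR_ge0.
  + by apply: filterS f0 => x ->; rewrite abse0 poweR0r.
- case: ifPn => // muT; apply: ess_sup_ae_cst => //.
  by apply: filterS f0 => x /= ->; rewrite abse0.
Qed.

End measure_lemmas.

(** * Balls and cubes *)

Section geometry.
Context (R : realType) (n : nat).
Hypothesis n_gt0 : (0 < n)%N.
Implicit Types (x y : euclid R n) (a : 'I_n -> R) (r s : R) (E : set (euclid R n)).
Local Notation mu := (lebesgue_n R n).

Lemma measurable_eucl_dist x : measurable_fun setT (eucl_dist x).
Proof.
apply: (measurableT_comp (continuous_measurable_fun (@sqrt_continuous R))).
apply: measurable_sum => i; apply: measurable_funX.
by apply: measurable_funB => //; exact: (@measurable_tnth _ (measurableTypeR R) n i).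
Qed.

Lemma measurable_eucl_ball x r : measurable (eucl_ball x r).
Proof.
have := measurable_fun_ltr (measurable_eucl_dist x) (measurable_cst r).
move=> /(_ measurableT [set true] I); rewrite setTI.
by congr (measurable _); apply/seteqP; split.
Qed.

Lemma eucl_dist_ge0 x y : 0 <= eucl_dist x y.
Proof. exact: sqrtr_ge0. Qed.

Lemma eucl_dist_tnth x y i : `|tnth x i - tnth y i| <= eucl_dist x y.
Proof.
rewrite -sqrtr_sqr ler_wsqrtr// (bigD1 i)//= lerDl.
by apply: sumr_ge0 => j _; exact: sqr_ge0.
Qed.

(** The crude factor n, in place of the square root of n, comes from n <= n^2 and spares a second
    root. *)
Lemma eucl_dist_le x y s : 0 <= s ->
  (forall i, `|tnth x i - tnth y i| <= s) -> eucl_dist x y <= n%:R * s.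
Proof.
move=> s0 xys; rewrite -(@ger0_norm _ (n%:R * s)) ?mulr_ge0// -sqrtr_sqr ler_wsqrtr//.
apply: (@le_trans _ _ (\sum_(i < n) s ^+ 2)).
  apply: ler_sum => i _; rewrite -real_normK ?num_real//.
  by rewrite lerXn2r// nnegrE.
rewrite sumr_const card_ord exprMn -[X in X <= _]mulr_natl ler_wpM2r ?sqr_ge0//.
by rewrite -natrX ler_nat; case: n n_gt0 => // k _; rewrite expnS leq_pmulr.
Qed.

(** Here [a] is the lower corner. Half-open sides let the cubes obtained by bisecting every side
    tile the original one. *)
Definition cube a s : set (euclid R n) :=
  [set y | forall i, (tnth y i : measurableTypeR R) \in `[a i, a i + s[%R].

Lemma measurable_cube a s : measurable (cube a s).
Proof.
rewrite (_ : cube a s =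
    \bigcap_(i in [set: 'I_n]) ((fun y => tnth y i) @^-1` [set` `[a i, a i + s[])).
  apply: fin_bigcap_measurable => // i _; rewrite -[X in measurable X]setTI.
  exact: (@measurable_tnth _ (measurableTypeR R) n i).
by apply/seteqP; split => y /= h i; [move=> _; exact: h|exact: h].
Qed.

Lemma mu_cube a s : 0 <= s -> mu (cube a s) = (s ^+ n)%:E.
Proof.
move=> s0; rewrite /cube (@lebesgue_n_box R n (fun i => [set` `[a i, a i + s[] : set (measurableTypeR R)))//.
under eq_bigr => i _.
  rewrite lebesgue_measure_itv /= (_ : (if _ then _ else _) = s%:E); first over.
  rewrite lte_fin ltrDl; case: ltP => [_|s0'].
    by rewrite -EFinB addrAC subrr add0r.
  by congr EFin; apply/eqP; rewrite eq_le s0.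
by rewrite prodEFin prodr_const card_ord.
Qed.

Lemma eucl_ball_sub_cube x r : eucl_ball x r `<=` cube (fun i => tnth x i - r) (2 * r).
Proof.
move=> y /= xyr i; have := le_lt_trans (eucl_dist_tnth x y i) xyr.
by rewrite ltr_norml in_itv/= => /andP[? ?]; apply/andP; split; lra.
Qed.

Lemma cube_sub_eucl_ball x a r s : 0 <= s -> n%:R * s < r ->
  (forall i, a i <= tnth x i <= a i + s) -> cube a s `<=` eucl_ball x r.
Proof.
move=> s0 sr xa y ya /=; apply: le_lt_trans sr; apply: eucl_dist_le => // i.
have := xa i; have := ya i; rewrite in_itv/= ler_norml.
by move=> /andP[? ?] /andP[? ?]; apply/andP; split; lra.
Qed.

Lemma mu_eucl_ball_le x r : 0 <= r -> (mu (eucl_ball x r) <= ((2 * r) ^+ n)%:E)%E.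
Proof.
move=> r0; rewrite -(mu_cube (fun i => tnth x i - r)) ?mulr_ge0//.
apply: le_measure; rewrite ?inE; [exact: measurable_eucl_ball|exact: measurable_cube|].
exact: eucl_ball_sub_cube.
Qed.

Lemma mu_eucl_ball_ge x r : 0 < r -> (((r / (2 * n%:R)) ^+ n)%:E <= mu (eucl_ball x r))%E.
Proof.
move=> r0; have n0 : 0 < n%:R :> R by rewrite ltr0n.
have s0 : 0 <= r / (2 * n%:R) by rewrite divr_ge0// ltW// mulr_gt0.
(* The cube with lower corner x and side r/(2n) lies within distance r/2 of x. *)
rewrite -(mu_cube (tnth x)) //.
apply: le_measure; rewrite ?inE; [exact: measurable_cube|exact: measurable_eucl_ball|].
apply: cube_sub_eucl_ball => //.
  by rewrite invfM mulrC -!mulrA mulVf ?gt_eqF// mulr1; lra.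
by move=> i; rewrite lexx lerDl.
Qed.

Lemma volumeE x r : 0 <= r -> mu (eucl_ball x r) = (volume (eucl_ball x r))%:E.
Proof.
move=> r0; rewrite /volume fineK// ge0_fin_numE//.
by apply: le_lt_trans (mu_eucl_ball_le x r0) _; rewrite ltry.
Qed.

(** This is |B|^(1/n). Only its comparability with r is used, so the volume of the unit ball is
    never computed. *)
Definition scale x r := volume (eucl_ball x r) `^ n%:R^-1.

Lemma scale_le x r : 0 <= r -> scale x r <= 2 * r.
Proof.
move=> r0; have n0 : n%:R != 0 :> R by rewrite pnatr_eq0 -lt0n.
rewrite -[leRHS](@powRr1 _ (2 * r)) ?mulr_ge0// -[X in _ <= _ `^ X](mulfV n0) powRrM.
rewrite powR_mulrn ?mulr_ge0//; apply: ge0_ler_powR; rewrite ?nnegrE ?invr_ge0//.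
- by rewrite fine_ge0.
- by rewrite exprn_ge0// mulr_ge0.
- by rewrite -lee_fin -volumeE// mu_eucl_ball_le.
Qed.

Lemma scale_ge x r : 0 < r -> r / (2 * n%:R) <= scale x r.
Proof.
move=> r0; have n0 : n%:R != 0 :> R by rewrite pnatr_eq0 -lt0n.
have s0 : 0 <= r / (2 * n%:R) by rewrite divr_ge0 ?mulr_ge0// ltW.
rewrite -[leLHS]powRr1// -[X in _ `^ X <= _](mulfV n0) powRrM.
rewrite powR_mulrn//; apply: ge0_ler_powR; rewrite ?nnegrE ?invr_ge0//.
- by rewrite exprn_ge0.
- by rewrite fine_ge0.
- by rewrite -lee_fin -volumeE ?(ltW r0)// mu_eucl_ball_ge.
Qed.

Lemma scale_gt0 x r : 0 < r -> 0 < scale x r.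
Proof.
move=> r0; apply: lt_le_trans (scale_ge x r0).
by rewrite divr_gt0// mulr_gt0// ltr0n.
Qed.

Lemma volume_powR x r s : volume (eucl_ball x r) `^ (s / n%:R) = scale x r `^ s.
Proof. by rewrite mulrC powRrM. Qed.

End geometry.

(** * Points of positive lower density *)

Section density.
Context (R : realType) (n : nat).
Hypothesis n_gt0 : (0 < n)%N.
Implicit Types (x y : euclid R n) (a : 'I_n -> R) (r s : R) (E : set (euclid R n)).
Local Notation mu := (lebesgue_n R n).

(** Pigeonhole: 2^n half-size subcubes cover the cube, so the richest of them carries at least the
    average share of [E]. *)
Lemma cube_bisect E a s : measurable E -> 0 <= s ->
  exists a', (forall i, a i <= a' i /\ a' i + s / 2 <= a i + s) /\
    (mu (E `&` cube a s) <= (2 ^+ n)%:E * mu (E `&` cube a' (s / 2)))%E.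
Proof.
move=> mE s0.
pose c (f : {ffun 'I_n -> bool}) i := a i + (if f i then s / 2 else 0).
pose F f := E `&` cube (c f) (s / 2).
have mF f : measurable (F f) by apply: measurableI => //; exact: measurable_cube.
have [f _ fmax] := @Order.TotalTheory.arg_maxP _ _ _ [ffun=> false] predT
  (fun f => mu (F f)) isT.
exists (c f); split.
  by move=> i; rewrite /c; case: (f i); split; lra.
have cov : E `&` cube a s `<=` \bigcup_f F f.
  (* The subcube containing y is read off by comparing each coordinate with the midpoint of its
     side. *)
  move=> y [Ey ya]; exists [ffun i => a i + s / 2 <= tnth y i] => //; split => // i.
  have := ya i; rewrite /c ffunE /= !in_itv/= => /andP[? ?].
  by case: (leP (a i + s / 2) (tnth y i)) => ?; apply/andP; split; lra.
have mQ : measurable (E `&` cube a s) by apply: measurableI => //; exact: measurable_cube.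
apply: le_trans (measure_le_sum_cover mu mQ mF cov) _.
apply: (@le_trans _ _ (\sum_(g : {ffun 'I_n -> bool}) mu (F f))%E).
  by apply: lee_sum => g _; exact: fmax.
under eq_bigr do rewrite -[mu _]mul1e.
rewrite -ge0_sume_distrl => [|? _]; last exact: lee01.
by rewrite sumEFin sumr_const card_ffun card_bool card_ord natrX.
Qed.

(* Repeatedly halving a cube and keeping the richest half-size subcube gives
   nested cubes carrying at least their fair share of E. *)
Lemma density_point E a s : measurable E -> 0 < s -> E `<=` cube a s ->
  (0 < mu E)%E ->
  exists x, exists2 t : R, 0 < t &
    forall r, 0 < r <= s -> ((t * r ^+ n)%:E <= mu (E `&` eucl_ball x r))%E.
Proof.
move=> mE s0 Ea E0.
pose ss j := s / 2 ^+ j.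
have ss0 j : 0 < ss j by rewrite divr_gt0// exprn_gt0.
have ssS j : ss j.+1 = ss j / 2 by rewrite /ss exprSr invfM mulrA.
pose step b j := sval (cid (cube_bisect b mE (ltW (ss0 j)))).
have stepP b j := svalP (cid (cube_bisect b mE (ltW (ss0 j)))).
pose fix aa j := if j is j'.+1 then step (aa j') j' else a.
have aaS j : aa j.+1 = step (aa j) j by [].
have aa_mu j : (mu E <= ((2 ^+ n) ^+ j)%:E * mu (E `&` cube (aa j) (ss j)))%E.
  elim: j => [|j IH].
    by rewrite expr0 mul1e /ss expr0 divr1 /= (setIidl Ea).
  apply: le_trans IH _; rewrite exprSr EFinM -muleA lee_pmul2l ?lte_fin ?exprn_gt0//.
  by rewrite ssS; have [_] := stepP (aa j) j.
have aaD j k i : aa j i <= aa (j + k)%N i /\ aa (j + k)%N i + ss (j + k)%N <= aa j i + ss j.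
  elim: k => [|k [IH1 IH2]]; first by rewrite addn0.
  rewrite addnS ssS aaS; have [/(_ i)[h1 h2] _] := stepP (aa (j + k)%N) (j + k)%N.
  by split; [exact: le_trans IH1 h1|exact: le_trans h2 IH2].
have aa_lt j k i : aa j i <= aa k i + ss k.
  have [_ h1] := aaD k (j - k)%N i; have [h2 _] := aaD j (k - j)%N i.
  have h3 := ss0 (k + (j - k))%N; have h4 := ss0 k.
  case: (leqP j k) => jk; first by move: h2; rewrite subnKC//; lra.
  by move: h1 h3; rewrite subnKC 1?ltnW//; lra.
(* The lower corners increase and stay below every upper corner, so their supremum lies in the
   closure of every cube of the sequence. *)
pose xi i := sup (range (aa ^~ i)).
have xi_ge j i : aa j i <= xi i.
  apply: ub_le_sup; last by exists j.
  by exists (a i + s) => _ [k _ <-]; have := aa_lt k 0%N i; rewrite /ss expr0 divr1.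
have xi_le j i : xi i <= aa j i + ss j.
  by apply: ge_sup; [exists (aa 0%N i); exists 0%N|move=> _ [k _ <-]; exact: aa_lt].
have n1 : 1 <= n%:R :> R by rewrite ler1n.
have n0 : 0 < n%:R :> R by rewrite ltr0n.
have Efin : (mu E < +oo)%E.
  apply: (@le_lt_trans _ _ (mu (cube a s))); last by rewrite mu_cube ?(ltW s0)// ltry.
  by apply: le_measure; rewrite ?inE//; exact: measurable_cube.
(* The j-th cube has side s/2^j and carries at least 2^(-jn) of the mass of [E]. For the j chosen
   below, r <= 2n * s/2^j, so this share is at least (r/(2ns))^n. *)
exists [tuple xi i | i < n], (fine (mu E) / (2 * n%:R * s) ^+ n).
  by rewrite divr_gt0 ?exprn_gt0 ?mulr_gt0// fine_gt0// E0.
move=> r /andP[r0 rs].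
have exj : exists j, n%:R * ss j < r.
  exists (Num.bound (n%:R * s / r)).
  have := archi_boundP (divr_ge0 (mulr_ge0 (ltW n0) (ltW s0)) (ltW r0)).
  set N := Num.bound _ => hN.
  rewrite /ss mulrA ltr_pdivrMr ?exprn_gt0// [ltRHS]mulrC -ltr_pdivrMr//.
  by apply: lt_trans hN _; rewrite -natrX ltr_nat ltn_expl.
(* The first cube small enough to fit in the ball. Since r <= s it is not the initial one, and the
   failure of its predecessor bounds r from above by its side. *)
case: (ex_minnP exj) => j jr jmin.
have j0 : (0 < j)%N.
  rewrite lt0n; apply/eqP => j0; move: jr; rewrite j0 /ss expr0 divr1 ltNge => /negP; apply.
  by apply: le_trans rs _; rewrite ler_peMl// ltW.
have rj : r <= 2 * n%:R * ss j.
  have : r <= n%:R * ss j.-1.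
    rewrite leNgt; apply/negP => /jmin; rewrite leqNgt prednK//.
    by rewrite leqnn.
  by rewrite -[in ss j](prednK j0) ssS; lra.
have sub : cube (aa j) (ss j) `<=` eucl_ball [tuple xi i | i < n] r.
  apply: cube_sub_eucl_ball (jr) _ => //; first exact: ltW.
  by move=> i; rewrite tnth_mktuple xi_ge xi_le.
apply: (@le_trans _ _ (mu (E `&` cube (aa j) (ss j)))); last first.
  apply: le_measure; rewrite ?inE; last exact: setIS.
  - by apply: measurableI => //; exact: measurable_cube.
  - by apply: measurableI => //; exact: measurable_eucl_ball.
have := aa_mu j; rewrite -exprM mulnC exprM.
have Qfin : mu (E `&` cube (aa j) (ss j)) \is a fin_num.
  rewrite ge0_fin_numE//; apply: le_lt_trans Efin; apply: le_measure; rewrite ?inE//.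
  by apply: measurableI => //; exact: measurable_cube.
rewrite -(fineK Qfin); move: (fine (mu (E `&` _))) (fine_ge0 (measure_ge0 mu (E `&` cube (aa j) (ss j)))) => z z0.
have := E0; have := Efin; case: (mu E) => [e| |]//= _ e0.
rewrite -EFinM !lee_fin => eb.
rewrite mulrAC ler_pdivrMr ?exprn_gt0 ?mulr_gt0//.
apply: (@le_trans _ _ (((2 ^+ j) ^+ n * z) * r ^+ n)).
  by rewrite ler_wpM2r// exprn_ge0// ltW.
have -> : (2 ^+ j) ^+ n * z * r ^+ n = z * (2 ^+ j * r) ^+ n by rewrite exprMn; ring.
apply: ler_wpM2l => //; apply: lerXn2r; rewrite ?nnegrE.
- by rewrite mulr_ge0 ?exprn_ge0// ltW.
- by rewrite !mulr_ge0// ltW.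
rewrite mulrC -ler_pdivlMr ?exprn_gt0//; apply: le_trans rj _.
by rewrite /ss mulrA.
Qed.

End density.

(** * Lower bounds for the factors *)

Section powR_lemmas.
Context (R : realType).
Implicit Types (s t u e : R).

(** The power is monotone in t, in a direction given by the sign of e; the sum of both endpoint
    values avoids having to know that sign. *)
Lemma powR_le_endpoints s t u e : 0 < s -> s <= t <= u -> t `^ e <= s `^ e + u `^ e.
Proof.
move=> s0 /andP[st tu]; have t0 := lt_le_trans s0 st; have u0 := lt_le_trans t0 tu.
have [e0|e0] := leP 0 e.
  by rewrite ler_wpDl ?powR_ge0// ge0_ler_powR// nnegrE ltW.
rewrite ler_wpDr ?powR_ge0// -(opprK e) !(powRN _ (- e)) lef_pV2 ?posrE ?powR_gt0//.
by rewrite ge0_ler_powR ?oppr_ge0// ?nnegrE ltW.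
Qed.

Lemma powR_inv t e : 0 <= t -> t^-1 `^ e = (t `^ e)^-1.
Proof. by move=> t0; rewrite -powR_inv1// -powRrM mulN1r powRN. Qed.

Lemma powR_unbounded e : e < 0 -> forall M, exists2 r, 0 < r &
  forall t, 0 < t <= r -> M <= t `^ e.
Proof.
move=> e0 M; pose M1 := Num.max M 1.
have M0 : 0 < M1 by rewrite lt_max ltr01 orbT.
exists (M1 `^ e^-1); first exact: powR_gt0.
move=> t /andP[t0 tr]; apply: (@le_trans _ _ M1); first by rewrite le_max lexx.
rewrite -[leLHS]powRr1 ?(ltW M0)// -(mulVf (negbT (lt_eqF e0))) powRrM.
rewrite -(opprK e) !(powRN _ (- e)) lef_pV2 ?posrE ?powR_gt0// ?powR_gt0//.
by rewrite opprK ge0_ler_powR ?oppr_ge0 ?(ltW e0)// nnegrE ?powR_ge0 ?(ltW t0).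
Qed.

(** With t = |x - y|, this puts the step function summing 2^(jn) over the balls B(x, 2^-j) below a
    multiple of (|x - y| + 2^-J)^-n. A geometric sum is controlled by its last term. *)
Lemma dyadic_sum_le (n J : nat) t : (0 < n)%N -> 0 <= t ->
  (\sum_(j < J) (2 ^+ j) ^+ n * (t < (2 ^+ j)^-1)%R%:R) * (t + (2 ^+ J)^-1) ^+ n
    <= 4 ^+ n.
Proof.
move=> n0 t0.
have geom K : \sum_(j < K) (2 ^+ j) ^+ n <= (2 ^+ K) ^+ n :> R.
  elim: K => [|K IH]; first by rewrite big_ord0 expr0 expr1n.
  rewrite big_ord_recr /= exprS [leRHS]exprMn.
  apply: (@le_trans _ _ (2 * (2 ^+ K) ^+ n)); first by rewrite mulrDl mul1r lerD2r.
  rewrite ler_wpM2r ?exprn_ge0// -[leLHS]expr1 ler_weXn2l// ler1n//.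
elim: J => [|J IH]; first by rewrite big_ord0 mul0r exprn_ge0.
have J0 : 0 < (2 ^+ J.+1)^-1 :> R by rewrite invr_gt0 exprn_gt0.
have JS : (2 ^+ J)^-1 = 2 * (2 ^+ J.+1)^-1 :> R.
  by rewrite exprS invfM mulrA mulfV ?mul1r// pnatr_eq0.
(* If t < 2^-J, all terms may count, but the second factor is at most 3 * 2^-(J+1). Otherwise the
   new term is 0 and the second factor only decreases. *)
have [tJ|tJ] := ltP t (2 ^+ J)^-1.
  apply: (@le_trans _ _ ((2 ^+ J.+1) ^+ n * (4 * (2 ^+ J.+1)^-1) ^+ n)); last first.
    by rewrite -exprMn mulrCA mulfV ?mulr1// expf_neq0// pnatr_eq0.
  apply: ler_pM.
  - by apply: sumr_ge0 => j _; rewrite mulr_ge0 ?exprn_ge0.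
  - by rewrite exprn_ge0// addr_ge0// ltW.
  - apply: le_trans (geom _); apply: ler_sum => j _.
    by rewrite ler_piMr ?exprn_ge0//; case: (_ < _); rewrite ?lexx ?ler01.
  - by apply: lerXn2r; rewrite ?nnegrE; lra.
rewrite big_ord_recr /= ltNge tJ /= mulr0 addr0; apply: le_trans IH.
apply: ler_wpM2l; first by apply: sumr_ge0 => j _; rewrite mulr_ge0 ?exprn_ge0.
by apply: lerXn2r; rewrite ?nnegrE; lra.
Qed.

End powR_lemmas.

Section factor.
Context (R : realType) (n m : nat) (delta : R).
Hypothesis n_gt0 : (0 < n)%N.
Variables (p : \bar R) (b : R) (v : euclid R n -> \bar R).
Hypothesis p_ge1 : (1 <= p)%E.
Local Notation mu := (lebesgue_n R n).
Local Notation a := (n%:R - b + delta / m%:R).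
Local Notation s := (fine p^-1).
Local Notation factor x r := (H_factor m delta p b v x (eucl_ball x r)).

(** The common source of all power-type bounds: on the test set [S] the weight is at most [k] and
    the base of the kernel stays in [lo, hi], which bounds the integrand from below. *)
Lemma H_factor_ge x r (S : set (euclid R n)) (k lo hi : R) : 0 < r ->
  measurable S -> (0 < mu S < +oo)%E -> 0 < k -> 0 < lo ->
  (forall y, S y -> (0 < v y <= k%:E)%E /\ lo <= scale x r + eucl_dist x y <= hi) ->
  (((k * (lo `^ a + hi `^ a))^-1 * fine (mu S) `^ (1 - s))%:E <= factor x r)%E.
Proof.
move=> r0 mS muS k0 lo0 Sv; rewrite /H_factor.
have D0 : 0 < lo `^ a + hi `^ a by rewrite ltr_wpDr ?powR_ge0// powR_gt0.
apply: Lnorm_conjugate_ge => //.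
  by rewrite invr_ge0 mulr_ge0// ltW.
move=> y /Sv[/andP[v0 vk] lth]; rewrite -/(scale x r).
have vfin : v y \is a fin_num by rewrite ge0_fin_numE ?(ltW v0)// (le_lt_trans vk)// ltry.
move: v0 vk lth; rewrite -(fineK vfin) lte_fin lee_fin; set z := fine _; set t := scale x r + _.
move=> z0 zk lth; have t0 : 0 < t by case/andP: lth => /(lt_le_trans lo0).
have ta0 : 0 < t `^ a by exact: powR_gt0.
rewrite !inver !gt_eqF// -EFinM abse_EFin lee_fin ger0_norm; last first.
  by rewrite mulr_ge0// invr_ge0 ltW.
rewrite -invfM lef_pV2 ?posrE ?mulr_gt0//; apply: ler_pM => //; try exact: ltW.
exact: powR_le_endpoints.
Qed.

(* At the critical exponent every dyadic scale above r contributes the same amount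
   to the integral. *)
Lemma H_factor_log x (E : set (euclid R n)) (k t : R) : measurable E ->
  0 < k -> 0 < t -> (forall y, E y -> (0 < v y <= k%:E)%E) ->
  (forall r, 0 < r <= 1 -> ((t * r ^+ n)%:E <= mu (E `&` eucl_ball x r))%E) ->
  p != 1%E -> a = n%:R * (1 - s) ->
  exists2 c, 0 < c & forall J r, 0 < r -> 2 * r <= (2 ^+ J)^-1 ->
    (((c * J%:R) `^ (1 - s))%:E <= factor x r)%E.
Proof.
move=> mE k0 t0 vk Et pN1 aE; have [q0 qE] := hoelder_conjugateE p_ge1 pN1.
have a0 : 0 <= a by rewrite aE mulr_ge0// ltW.
set q := (1 - s)^-1; have {}q0 : 0 < q by rewrite invr_gt0.
(* At the critical exponent the kernel raised to p' is the power -n, which just fails to be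
   integrable at the origin. *)
have aqE : a * q = n%:R.
  by rewrite aE -mulrA mulfV ?mulr1// -[1 - s]invrK gt_eqF// invr_gt0.
have -> : 1 - s = q^-1 by rewrite invrK.
rewrite /H_factor qE -/q; clearbody q.
(* The factor k^q accounts for v <= k and 4^n is the constant of [dyadic_sum_le]. *)
pose c0 := (k `^ q * 4 ^+ n)^-1.
have c00 : 0 < c0 by rewrite invr_gt0 mulr_gt0 ?powR_gt0 ?exprn_gt0.
exists (c0 * t); first exact: mulr_gt0.
move=> J r r0 rJ.
pose A j := E `&` eucl_ball x ((2 ^+ j)^-1).
have mA j : measurable (A j) by apply: measurableI => //; exact: measurable_eucl_ball.
pose g (j : 'I_J) y := ((c0 * (2 ^+ j) ^+ n) * \1_(A j) y)%:E.
have g0 j y : (0 <= g j y)%E by rewrite lee_fin !mulr_ge0 ?exprn_ge0// ltW.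
rewrite unlock; set I := (X in (_ <= X `^ _)%E).
have gI : (\int[mu]_y (\sum_(j < J) g j y) <= I)%E.
  apply: le_integral_ge0 => y; first exact: sume_ge0.
  rewrite sumEFin; have [Ey|nEy] := pselect (E y); last first.
    rewrite big1 ?poweR_ge0// => j _; rewrite /A indicE memNset ?mulr0//.
    by move=> [].
  have /andP[v0 vyk] := vk _ Ey.
  have vfin : v y \is a fin_num by rewrite ge0_fin_numE ?(ltW v0)// (le_lt_trans vyk)// ltry.
  move: v0 vyk; rewrite -(fineK vfin) lte_fin lee_fin; set z := fine _ => z0 zk.
  rewrite -/(scale x r); set w := scale x r + _.
  have w0 : 0 < w by rewrite ltr_wpDr ?eucl_dist_ge0// scale_gt0.
  set d := eucl_dist x y; have d0 : 0 <= d by exact: eucl_dist_ge0.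
  (* The scale is at most 2r, hence at most 2^-J. *)
  have wd : w <= d + (2 ^+ J)^-1.
    by rewrite /w addrC lerD2l (le_trans _ rJ)// scale_le// ltW.
  rewrite !inver !gt_eqF ?powR_gt0// -EFinM abse_EFin poweR_EFin lee_fin.
  rewrite -invfM ger0_norm ?invr_ge0 ?mulr_ge0 ?powR_ge0 ?(ltW z0)//.
  have wa0 : 0 < z * w `^ a by rewrite mulr_gt0// powR_gt0.
  rewrite powR_inv ?(ltW wa0)// powRM ?powR_ge0 ?(ltW z0)// -powRrM aqE powR_mulrn ?(ltW w0)//.
  under eq_bigr do rewrite -mulrA.
  rewrite -mulr_sumr.
  have zw0 : 0 < z `^ q * w ^+ n by rewrite mulr_gt0 ?powR_gt0 ?exprn_gt0.
  rewrite -[leRHS]mul1r ler_pdivlMr//.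
  have -> : \sum_(j < J) (2 ^+ j) ^+ n * \1_(A j) y =
      \sum_(j < J) (2 ^+ j) ^+ n * (d < (2 ^+ j)^-1)%R%:R :> R.
    apply: eq_bigr => j _; rewrite indicE; congr (_ * (nat_of_bool _)%:R).
    by apply/idP/idP => [|dj]; [rewrite inE => -[]|rewrite inE; split].
  have S0 : 0 <= \sum_(j < J) (2 ^+ j) ^+ n * (d < (2 ^+ j)^-1)%R%:R :> R.
    by apply: sumr_ge0 => j _; rewrite mulr_ge0 ?exprn_ge0.
  rewrite /c0 -mulrA mulrC ler_pdivrMr ?mul1r ?mulr_gt0 ?powR_gt0 ?exprn_gt0//.
  rewrite mulrCA; apply: ler_pM; rewrite ?powR_ge0 ?mulr_ge0 ?exprn_ge0 ?(ltW w0)//.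
    by rewrite ge0_ler_powR ?nnegrE ?(ltW q0) ?(ltW z0) ?(ltW k0).
  apply: le_trans (dyadic_sum_le J n_gt0 d0); apply: ler_wpM2l => //.
  by apply: lerXn2r; rewrite ?nnegrE ?(ltW w0)// (le_trans (ltW w0)).
rewrite -poweR_EFin; apply: gt0_ler_poweR; rewrite ?in_itv/= ?leey ?andbT.
- by rewrite invr_ge0 ltW.
- by rewrite lee_fin !mulr_ge0// ltW.
- by apply: le_trans gI; apply: integral_ge0 => y _; exact: sume_ge0.
apply: le_trans gI; rewrite ge0_integral_sum//; last first.
  by move=> j; apply/measurable_EFinP; apply: measurable_funM => //.
(* Each dyadic scale contributes at least c0 * t: the height 2^(jn) cancels the mass t * 2^(-jn) of
   [E] in B(x, 2^-j). *)
apply: (@le_trans _ _ (\sum_(j < J) (c0 * t)%:E)%E).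
  by rewrite sumEFin sumr_const card_ord mulr_natr.
apply: lee_sum => j _.
under eq_integral do rewrite /g EFinM.
rewrite ge0_integralZl_EFin//; last 2 first.
- by apply/measurable_EFinP; exact: measurable_indic.
- by rewrite mulr_ge0 ?exprn_ge0// ltW.
rewrite integral_indic// setIT.
have j0 : 0 < (2 ^+ j)^-1 :> R by rewrite invr_gt0 exprn_gt0.
apply: (@le_trans _ _ ((c0 * (2 ^+ j) ^+ n)%:E * (t * ((2 ^+ j)^-1) ^+ n)%:E)%E).
  by rewrite -EFinM lee_fin mulrACA -exprMn mulfV ?expr1n ?mulr1 ?lexx//.
rewrite lee_pmul2l ?lte_fin ?mulr_gt0 ?exprn_gt0//.
by apply: Et; rewrite j0 invf_le1 ?exprn_gt0// exprn_ege1// ler1n.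
Qed.

End factor.

(** * Behaviour of one factor at a point of positive lower density *)

Section factor_bounds.
Context (R : realType) (n m : nat) (delta : R).
Hypothesis n_gt0 : (0 < n)%N.
Variables (p : \bar R) (b : R) (v : euclid R n -> \bar R).
Hypothesis p_ge1 : (1 <= p)%E.
Variables (x : euclid R n) (E : set (euclid R n)) (k t : R).
Hypotheses (mE : measurable E) (k_gt0 : 0 < k) (t_gt0 : 0 < t).
Hypothesis v_le : forall y, E y -> (0 < v y <= k%:E)%E.
Hypothesis E_ge : forall r, 0 < r <= 1 ->
  ((t * r ^+ n)%:E <= lebesgue_n R n (E `&` eucl_ball x r))%E.
Local Notation mu := (lebesgue_n R n).
Local Notation a := (n%:R - b + delta / m%:R).
Local Notation s := (fine p^-1).
Local Notation factor r := (H_factor m delta p b v x (eucl_ball x r)).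

Let s_le1 : 0 <= 1 - s.
Proof. by have /andP[_ s1] := fine_inve_itv p_ge1; rewrite subr_ge0. Qed.

(** For y in B(x, r) the base rho + |x - y|, with rho the scale, lies between rho and (1 + 2n) rho,
    because r <= 2n rho. *)
Let near_cst := (k * (1 + (1 + 2 * n%:R) `^ a))^-1.

Let near_cst_gt0 : 0 < near_cst.
Proof. by rewrite invr_gt0 mulr_gt0// ltr_wpDr ?powR_ge0. Qed.

(** The test set is left free so that it can be all of [E] in the ball for small r, or a fixed piece
    of [E] for large r. *)
Lemma H_factor_near r (S : set (euclid R n)) (u : R) : 0 < r -> measurable S ->
  S `<=` E `&` eucl_ball x r -> 0 < u -> (u%:E <= mu S)%E ->
  ((near_cst * scale x r `^ (- a) * u `^ (1 - s))%:E <= factor r)%E.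
Proof.
move=> r0 mS SE u0 uS; have z0 := scale_gt0 n_gt0 x r0.
have n0 : 0 < n%:R :> R by rewrite ltr0n.
have Sfin : (mu S < +oo)%E.
  apply: (@le_lt_trans _ _ (mu (eucl_ball x r))); last first.
    by rewrite volumeE ?ltry// ltW.
  apply: le_measure; rewrite ?inE//; first exact: measurable_eucl_ball.
  by move=> y /SE[].
have S0 : (0 < mu S)%E by apply: lt_le_trans uS; rewrite lte_fin.
have := @H_factor_ge R n m delta p b v p_ge1 x r S k (scale x r)
  ((1 + 2 * n%:R) * scale x r) r0 mS.
rewrite S0 Sfin => /(_ isT k_gt0 z0) h; apply: le_trans (h _); last first.
  move=> y /SE[Ey xyr]; split; first exact: v_le.
  rewrite lerDl eucl_dist_ge0 /= mulrDl mul1r lerD2l ltW// (lt_le_trans xyr)//.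
  have := scale_ge n_gt0 x r0; rewrite ler_pdivrMr ?mulr_gt0//; lra.
rewrite lee_fin powRM ?(ltW z0)//.
have -> : (k * (scale x r `^ a + (1 + 2 * n%:R) `^ a * scale x r `^ a))^-1 =
    near_cst * scale x r `^ (- a).
  by rewrite powRN -invfM; congr (_^-1); ring.
apply: ler_pM => //.
- by rewrite mulr_ge0 ?powR_ge0// ltW.
- exact: powR_ge0.
- rewrite ge0_ler_powR// ?nnegrE ?fine_ge0 ?(ltW u0)//.
  by rewrite -lee_fin fineK// ge0_fin_numE.
Qed.

(** The test set is the part of [E] in B(x, r), whose mass t r^n is at least t (rho/2)^n since rho
    <= 2r. *)
Lemma H_factor_scale : exists2 c, 0 < c &
  forall r, 0 < r <= 1 ->
    ((c * scale x r `^ (n%:R * (1 - s) - a))%:E <= factor r)%E.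
Proof.
exists (near_cst * (t / 2 ^+ n) `^ (1 - s)).
  by rewrite mulr_gt0 ?powR_gt0// divr_gt0 ?exprn_gt0.
move=> r r01; have /andP[r0 r1] := r01.
have z0 := scale_gt0 n_gt0 x r0.
have u0 : 0 < t / 2 ^+ n * scale x r ^+ n by rewrite mulr_gt0 ?divr_gt0 ?exprn_gt0.
have mS : measurable (E `&` eucl_ball x r).
  by apply: measurableI => //; exact: measurable_eucl_ball.
apply: le_trans (H_factor_near r0 mS (@subset_refl _ _) u0 _).
  rewrite lee_fin (powRM _ (ltW (divr_gt0 t_gt0 _))) ?exprn_ge0 ?exprn_gt0 ?(ltW z0)//.
  rewrite -[scale x r ^+ n]powR_mulrn ?(ltW z0)// -powRrM.
  have -> : scale x r `^ (n%:R * (1 - s) - a) =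
      scale x r `^ (n%:R * (1 - s)) * scale x r `^ (- a).
    by rewrite powRD// (gt_eqF z0) implybT.
  by rewrite le_eqVlt; apply/orP; left; apply/eqP; ring.
apply: le_trans (E_ge r01); rewrite lee_fin -mulrA ler_wpM2l ?(ltW t_gt0)//.
rewrite -exprVn -exprMn; apply: lerXn2r; rewrite ?nnegrE ?mulr_ge0 ?invr_ge0 ?(ltW z0) ?(ltW r0)//.
by have := scale_le n_gt0 x (ltW r0); lra.
Qed.

Lemma H_factor_far : exists2 c, 0 < c &
  forall r, 1 <= r -> ((c * scale x r `^ (- a))%:E <= factor r)%E.
Proof.
exists (near_cst * t `^ (1 - s)); first by rewrite mulr_gt0 ?powR_gt0.
move=> r r1; have r0 : 0 < r by exact: lt_le_trans r1.
have mS : measurable (E `&` eucl_ball x 1).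
  by apply: measurableI => //; exact: measurable_eucl_ball.
rewrite mulrAC; apply: (@H_factor_near _ (E `&` eucl_ball x 1)) => //.
  by apply: setIS => y /= /lt_le_trans; exact.
by have := @E_ge 1; rewrite expr1n mulr1; apply; rewrite ltr01 lexx.
Qed.

(** A test set that avoids a fixed small ball around x keeps the base of the kernel between [l] and
    3, uniformly in r <= 1. *)
Lemma H_factor_cst : exists2 c, 0 < c &
  forall r, 0 < r <= 1 -> (c%:E <= factor r)%E.
Proof.
(* The ball B(x, l) has measure at most (2l)^n <= 2l <= t/2, so removing it leaves at least half of
   the guaranteed mass t. *)
pose l := Num.min 1 t / 4.
have l0 : 0 < l by rewrite divr_gt0// lt_min ltr01.
have lt4 : 4 * l <= t by rewrite /l mulrC divfK// ge_min lexx orbT.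
have l4 : 4 * l <= 1 by rewrite /l mulrC divfK// ge_min lexx.
clearbody l.
pose S := (E `&` eucl_ball x 1) `\` eucl_ball x l.
have mS : measurable S.
  by apply: measurableD; [apply: measurableI => //|]; exact: measurable_eucl_ball.
have S_ge : ((t / 2)%:E <= mu S)%E.
  have := @E_ge 1; rewrite expr1n mulr1 ltr01 lexx => /(_ isT) tE.
  have : (mu (E `&` eucl_ball x 1) <= mu S + (t / 2)%:E)%E.
    apply: (@le_trans _ _ (mu (S `|` eucl_ball x l))).
      apply: le_measure; rewrite ?inE.
      - by apply: measurableI => //; exact: measurable_eucl_ball.
      - by apply: measurableU => //; exact: measurable_eucl_ball.
      - by move=> y Ey; have [?|?] := pselect (eucl_ball x l y); [right|left].
    apply: le_trans (measureU2 _ _ _) _ => //; first exact: measurable_eucl_ball.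
    apply: leeD2l; apply: le_trans (mu_eucl_ball_le _ (ltW l0)) _.
    rewrite lee_fin; apply: (@le_trans _ _ (2 * l)); last by lra.
    rewrite -[leRHS]expr1 ler_wiXn2l ?mulr_ge0 ?(ltW l0)//; lra.
  move=> /(le_trans tE); rewrite -leeBlDr// -EFinB; apply: le_trans.
  by rewrite lee_fin; lra.
have Sfin : (mu S < +oo)%E.
  apply: (@le_lt_trans _ _ (mu (eucl_ball x 1))); last by rewrite volumeE ?ltry.
  apply: le_measure; rewrite ?inE//; first exact: measurable_eucl_ball.
  by move=> y [[]].
have S0 : (0 < mu S)%E by apply: lt_le_trans S_ge; rewrite lte_fin divr_gt0.
exists ((k * (l `^ a + 3 `^ a))^-1 * fine (mu S) `^ (1 - s)).
  rewrite mulr_gt0 ?powR_gt0 ?fine_gt0 ?S0// invr_gt0 mulr_gt0// ltr_wpDr ?powR_ge0//.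
  exact: powR_gt0.
move=> r /andP[r0 r1]; apply: H_factor_ge; rewrite ?S0 ?Sfin//.
move=> y [[Ey xy1] xyl]; split; first exact: v_le.
have := scale_gt0 n_gt0 x r0; have := scale_le n_gt0 x (ltW r0).
by move: xyl xy1; rewrite /eucl_ball/= => /negP; rewrite -leNgt => ? ? ? ?; apply/andP; split; lra.
Qed.

Lemma H_factor_unbounded : n%:R * (1 - s) - a < 0 \/
    (p != 1%E /\ a = n%:R * (1 - s)) ->
  forall M, exists2 r, 0 < r <= 1 & (M%:E <= factor r)%E.
Proof.
case=> [e0|[pN1 aE]] M.
- have [c c0 hc] := H_factor_scale.
  have [r0 r00 hr0] := powR_unbounded e0 (M / c).
  pose r := Num.min 1 (r0 / 2).
  have r_gt0 : 0 < r by rewrite lt_min ltr01 divr_gt0.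
  exists r; first by rewrite r_gt0 ge_min lexx.
  apply: le_trans (hc _ _); last by rewrite r_gt0 ge_min lexx.
  rewrite lee_fin mulrC -ler_pdivrMr// hr0// scale_gt0//=.
  apply: le_trans (scale_le n_gt0 x (ltW r_gt0)) _.
  by rewrite mulrC -ler_pdivlMr// ge_min lexx orbT.
- have [c c0 hc] := H_factor_log n_gt0 p_ge1 mE k_gt0 t_gt0 v_le E_ge pN1 aE.
  have [q0 _] := hoelder_conjugateE p_ge1 pN1.
  pose M1 := Num.max M 0; have M10 : 0 <= M1 by rewrite le_max lexx orbT.
  have MM1 : M <= M1 by rewrite le_max lexx.
  (* Enough dyadic scales for (c J)^(1 - s) to exceed [M1]; the radius 2^-J / 2 then meets the
     constraint of [H_factor_log]. *)
  pose J := Num.bound (M1 `^ (1 - s)^-1 / c).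
  have hJ : M1 `^ (1 - s)^-1 <= c * J%:R.
    rewrite mulrC -ler_pdivrMr// ltW// /J archi_boundP//.
    by rewrite divr_ge0 ?powR_ge0// ltW.
  clearbody J M1.
  have J0 : 0 < (2 ^+ J)^-1 :> R by rewrite invr_gt0 exprn_gt0.
  have J1 : (2 ^+ J)^-1 <= 1 :> R by rewrite invf_le1 ?exprn_gt0// exprn_ege1// ler1n.
  exists ((2 ^+ J)^-1 / 2).
    by rewrite divr_gt0//= ler_pdivrMr// mul1r (le_trans J1)// ler1n.
  apply: le_trans (hc J _ _ _); [|exact: divr_gt0|by rewrite mulrC divfK].
  rewrite lee_fin; apply: (le_trans MM1).
  rewrite -[leLHS]powRr1// -[X in _ `^ X <= _](mulVf (negbT (gt_eqF q0))) powRrM.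
  by apply: ge0_ler_powR; rewrite ?nnegrE ?powR_ge0// (le_trans _ hJ)// powR_ge0.
Qed.

End factor_bounds.

(** * The condition for genuine weights *)

Section ereal_products.
Context (R : realType).

Lemma prode_ge (I : finType) (f : I -> R) (F : I -> \bar R) :
  (forall i, 0 <= f i) -> (forall i, (f i)%:E <= F i)%E ->
  ((\prod_i f i)%:E <= \prod_i F i)%E.
Proof.
move=> f0 fF; rewrite -prodEFin.
(* Nonnegativity is carried along, since multiplying inequalities in \bar R requires it. *)
suff : (0 <= \prod_i (f i)%:E <= \prod_i F i)%E by case/andP.
apply: (@big_ind2 _ _ (fun x y => 0 <= x <= y)%E) => //.
- by rewrite lee01 lexx.
- move=> x1 x2 y1 y2 /andP[x0 x12] /andP[y0 y12].
  by rewrite mule_ge0//= lee_pmul.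
- by move=> i _; rewrite lee_fin f0 fF.
Qed.

Lemma prode_eq0 (I : finType) (F : I -> \bar R) i :
  F i = 0%E -> (\prod_j F j)%E = 0%E.
Proof. by move=> Fi0; rewrite (bigD1 i)//= Fi0 mul0e. Qed.

Lemma powR_sum (I : finType) (t : R) (e : I -> R) : 0 < t ->
  \prod_i t `^ e i = t `^ (\sum_i e i).
Proof.
move=> t0; apply: (big_rec2 (fun x y => x = t `^ y)); first by rewrite powRr0.
by move=> i x y _ ->; rewrite powRD// (gt_eqF t0) implybT.
Qed.

End ereal_products.

Section weights.
Context (R : realType) (n m : nat).
Hypothesis n_gt0 : (0 < n)%N.
Variables (w : euclid R n -> \bar R) (v : 'I_m -> euclid R n -> \bar R).
Hypotheses (w_weight : weight w) (v_weight : forall i, weight (v i)).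
Local Notation mu := (lebesgue_n R n).

Lemma weight_ae_fin (f : euclid R n -> \bar R) x r : weight f ->
  {ae mu, forall y, eucl_ball x r y -> f y \is a fin_num}.
Proof.
move=> [mf f0 foo]; apply: integrable_ae; first exact: measurable_eucl_ball.
apply/integrableP; split; first exact: measurable_funTS.
under eq_integral => y _ do rewrite gee0_abs ?(ltW (f0 y))//.
exact: foo.
Qed.

(** The sets [F k] exhaust the ball up to a null set, because w is positive and every v_i is finite
    a.e.; hence they cannot all be null. *)
Lemma weights_level_set : exists k : R, exists E : set (euclid R n),
  [/\ 0 < k, measurable E, E `<=` eucl_ball [tuple 0 | _ < n] 1, (0 < mu E)%E &
      forall y, E y -> (k^-1%:E <= w y)%E /\ forall i, (0 < v i y <= k%:E)%E].
Proof.
have [mw w0 _] := w_weight.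
set B := eucl_ball _ 1.
have mB : measurable B by exact: measurable_eucl_ball.
pose F k := (B `&` [set y | (k.+1%:R^-1%:E <= w y)%E]) `&`
  \bigcap_(i in [set: 'I_m]) [set y | (v i y <= k.+1%:R%:E)%E].
have mF k : measurable (F k).
  apply: measurableI; first exact: (emeasurable_fun_c_infty mB (measurable_funTS mw)).
  apply: fin_bigcap_measurable => // i _; have [mv _ _] := v_weight i.
  by rewrite -[X in measurable X]setTI; exact: emeasurable_fun_infty_c.
have [[k Fk]|noF] := pselect (exists k, (0 < mu (F k))%E).
  exists k.+1%:R, (F k); split => //.
    by move=> y [[]].
  move=> y [[_ wk] vk]; split => // i; have [_ v0 _] := v_weight i.
  by rewrite v0 /= vk.
exfalso.
have B0 : (0 < mu B)%E.
  apply: lt_le_trans (mu_eucl_ball_ge n_gt0 _ ltr01); rewrite lte_fin.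
  by rewrite exprn_gt0// divr_gt0// mulr_gt0// ltr0n.
suff /negligibleP : mu.-negligible B by move=> /(_ mB) B00; rewrite B00 ltxx in B0.
have : {ae mu, forall y i, B y -> v i y \is a fin_num}.
  by apply: filter_forall => i; exact: weight_ae_fin.
move=> vfin; apply: (@negligibleS _ _ _ mu
  ((\bigcup_k F k) `|` ~` [set y | forall i, B y -> v i y \is a fin_num])); last first.
  apply: negligibleU => //; apply: negligible_bigcup => k; apply/negligibleP => //.
  by apply/eqP; rewrite -[_ == _]negbK -measure_gt0; apply/negP => Fk; apply: noF; exists k.
move=> y By; have [yfin|] := pselect (forall i, B y -> v i y \is a fin_num); last by right.
left.
(* This dominates every v_i(y) and 1/w(y). If w(y) = +oo, its [fine] is 0 and the lower bound on w
   holds trivially. *)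
pose z := \sum_i fine (v i y) + (fine (w y))^-1.
exists (Num.bound z) => //.
have v0 i : 0 <= fine (v i y) by have [_ v0 _] := v_weight i; rewrite fine_ge0// ltW.
have s0 : 0 <= \sum_i fine (v i y) by exact: sumr_ge0.
have w0' : 0 <= (fine (w y))^-1 by rewrite invr_ge0 fine_ge0// ltW.
have zb : z <= (Num.bound z).+1%:R.
  apply: ltW; apply: lt_trans (archi_boundP (addr_ge0 s0 w0')) _.
  by rewrite ltr_nat.
have c0 : 0 < (Num.bound z).+1%:R :> R by [].
rewrite /F /=; set c := (Num.bound z).+1%:R in zb c0 *; clearbody c; rewrite {}/z in zb.
split; [split => //=|].
  have := w0 y; case: (w y) w0' zb => [u| |]//=; last by rewrite leey.
  rewrite lte_fin lee_fin => _ zb u0; rewrite -[leRHS]invrK lef_pV2 ?posrE ?invr_gt0//.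
  by apply: le_trans zb; rewrite lerDr.
move=> i _ /=; rewrite -(fineK (yfin i By)) lee_fin; apply: le_trans zb.
by rewrite (bigD1 i)//= -addrA lerDl addr_ge0// sumr_ge0.
Qed.

(** The norm of w on the ball is at least 1/k, as [E] has positive measure there. Replacing the
    factors by real lower bounds leaves an inequality between real numbers. *)
Lemma H_class_bound (delta delta' : R) (p : 'I_m -> \bar R) (b : 'I_m -> R)
    (E : set (euclid R n)) x (k : R) :
  H_class delta p b delta' w v -> measurable E -> 0 < k ->
  (forall r, 0 < r -> (0 < mu (E `&` eucl_ball x r))%E) ->
  (forall y, E y -> (k^-1%:E <= w y)%E) ->
  exists C : R, forall r (f : 'I_m -> R), 0 < r -> (forall i, 0 <= f i) ->
    (forall i, (f i)%:E <=
      H_factor m delta (p i) (b i) (v i) x (eucl_ball x r))%E ->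
    scale x r `^ (delta - delta') * \prod_i f i <= C.
Proof.
move=> [C C0 HC] mE k0 E0 wk; exists (C * k) => r f r0 f0 fF.
have := HC x r r0; rewrite /= volume_powR.
have z0 := scale_gt0 n_gt0 x r0.
set W := Lnorm _ _ _ => HW.
have kW : (k^-1%:E <= W)%E.
  have mS : measurable (E `&` eucl_ball x r).
    by apply: measurableI => //; exact: measurable_eucl_ball.
  have Sfin : (mu (E `&` eucl_ball x r) < +oo)%E.
    apply: (@le_lt_trans _ _ (mu (eucl_ball x r))); last by rewrite volumeE ?ltry// ltW.
    by apply: le_measure; rewrite ?inE//; exact: measurable_eucl_ball.
  (* Exponent 1 is chosen because its conjugate is +oo. *)
  have := @Lnorm_conjugate_ge _ _ _ mu 1%E (fun y => w y * (\1_(eucl_ball x r) y)%:E)%E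
    (E `&` eucl_ball x r) k^-1 (lexx _) mS.
  rewrite E0// Sfin invr_ge0 (ltW k0) hoelder_conjugate1 inve1 /= subrr powRr0 mulr1.
  apply=> // y [Ey By]; rewrite indicE mem_set// mule1 (le_trans (wk _ Ey))//.
  exact: lee_abs.
have fP := prode_ge f0 fF.
have P0 : 0 <= \prod_i f i by exact: prodr_ge0.
rewrite -ler_pdivrMr// -lee_fin; apply: le_trans HW.
rewrite inver (gt_eqF (powR_gt0 _ z0)) -powRN opprB.
rewrite mulrAC EFinM; apply: lee_pmul => //.
- by rewrite lee_fin mulr_ge0 ?powR_ge0// invr_ge0 ltW.
- by rewrite mulrC EFinM; apply: lee_pmul; rewrite ?lee_fin ?powR_ge0 ?invr_ge0 ?(ltW k0) ?lexx.
Qed.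

End weights.

Section scale_limits.
Context (R : realType) (n : nat).
Hypothesis n_gt0 : (0 < n)%N.

Lemma scale_powR_small (x : euclid R n) (e M : R) : e < 0 ->
  exists2 r, 0 < r <= 1 & M <= scale x r `^ e.
Proof.
move=> e0; have [r0 r00 hr0] := powR_unbounded e0 M.
have r_gt0 : 0 < Num.min 1 (r0 / 2) by rewrite lt_min ltr01 divr_gt0.
exists (Num.min 1 (r0 / 2)); first by rewrite r_gt0 ge_min lexx.
rewrite hr0// scale_gt0//=; apply: le_trans (scale_le n_gt0 x (ltW r_gt0)) _.
by rewrite mulrC -ler_pdivlMr// ge_min lexx orbT.
Qed.

Lemma scale_powR_large (x : euclid R n) (e M : R) : 0 < e ->
  exists2 r, 1 <= r & M <= scale x r `^ e.
Proof.
move=> e0; have [] := @powR_unbounded R (- e) _ M; first by rewrite oppr_lt0.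
move=> r0 r00 hr0; have n0 : 0 < 2 * n%:R :> R by rewrite mulr_gt0// ltr0n.
pose r := Num.max 1 (2 * n%:R * r0^-1).
have r1 : 1 <= r by rewrite le_max lexx.
have r_gt0 : 0 < r by exact: lt_le_trans r1.
have z0 := scale_gt0 n_gt0 x r_gt0.
exists r => //; have := hr0 (scale x r)^-1.
rewrite powRN powR_inv ?(ltW z0)// invrK; apply.
rewrite invr_gt0 z0 /= -[leRHS]invrK lef_pV2 ?posrE ?invr_gt0//.
apply: le_trans (scale_ge n_gt0 x r_gt0); rewrite ler_pdivlMr// mulrC.
by rewrite le_max lexx orbT.
Qed.

End scale_limits.

(** * Contradiction for genuine weights *)

Section no_weights.
Context (R : realType) (n m : nat).
Hypothesis n_gt0 : (0 < n)%N.
Variables (delta delta' : R) (p : 'I_m -> \bar R) (b : 'I_m -> R).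
Hypothesis p_ge1 : forall i, (1 <= p i)%E.
Variables (w : euclid R n -> \bar R) (v : 'I_m -> euclid R n -> \bar R).
Hypotheses (w_weight : weight w) (v_weight : forall i, weight (v i)).
Local Notation mu := (lebesgue_n R n).
Local Notation a i := (n%:R - b i + delta / m%:R).
Local Notation q i := (n%:R * (1 - fine (p i)^-1)).

(** When the b_i add up to beta, the sum of the q_i - a_i is beta - n/p - delta, and delta minus the
    sum of the a_i is beta - mn. The first two alternatives thus serve (a), the third (b) and the
    fourth (c). *)
Lemma not_H_class :
  [\/ delta < delta',
      delta + \sum_i (q i - a i) < delta',
      delta' = delta /\
        exists i, q i - a i < 0 \/ (p i != 1%E /\ a i = q i)
    | delta' < delta - \sum_i a i] ->
  ~ H_class delta p b delta' w v.
Proof.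
move=> cases H.
have [k [E [k0 mE EB E0 Ek]]] := weights_level_set n_gt0 w_weight v_weight.
have EQ := subset_trans EB (@eucl_ball_sub_cube R n _ _).
have [] := density_point n_gt0 mE _ EQ E0; first by rewrite mulr1.
move=> x [t t0 Et].
have E_ge r : 0 < r <= 1 -> ((t * r ^+ n)%:E <= mu (E `&` eucl_ball x r))%E.
  by move=> /andP[r0 r1]; apply: Et; rewrite r0/=; lra.
have v_le i y : E y -> (0 < v i y <= k%:E)%E by move=> /Ek[].
have E_gt0 r : 0 < r -> (0 < mu (E `&` eucl_ball x r))%E.
  move=> r0; have m0 : 0 < Num.min r 1 by rewrite lt_min r0 ltr01.
  apply: (@lt_le_trans _ _ (mu (E `&` eucl_ball x (Num.min r 1)))).
    apply: lt_le_trans (E_ge _ _); first by rewrite lte_fin mulr_gt0 ?exprn_gt0.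
    by rewrite m0 ge_min lexx orbT.
  apply: le_measure; rewrite ?inE; try by apply: measurableI => //; exact: measurable_eucl_ball.
  by apply: setIS => y /= /lt_le_trans; apply; rewrite ge_min lexx.
have [C HC] := H_class_bound n_gt0 H mE k0 E_gt0 (fun y Ey => (Ek y Ey).1).
have absurd (c : R) (K : R) : 0 < c -> C / c + 1 <= K -> K * c <= C -> False.
  by move=> c0 h; rewrite -ler_pdivlMr// => h'; have := le_trans h h'; lra.
have prod_gt0 (c : 'I_m -> R) : (forall i, 0 < c i) -> 0 < \prod_i c i.
  by move=> c0; apply: prodr_gt0.
have bnd i := H_factor_cst m delta n_gt0 (b i) (p_ge1 i) mE k0 t0 (v_le i) E_ge.
have /choice[c hc] : forall i, exists c, 0 < c /\ forall r, 0 < r <= 1 ->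
    (c%:E <= H_factor m delta (p i) (b i) (v i) x (eucl_ball x r))%E.
  by move=> i; have [c ? ?] := bnd i; exists c.
have c0 i : 0 < c i by have [] := hc i.
case: cases.
- move=> dd; have [|r r01 hr] := scale_powR_small n_gt0 x (C / \prod_i c i + 1) (e := delta - delta').
    by rewrite subr_lt0.
  have /andP[r0 _] := r01.
  apply: (absurd (\prod_i c i)) hr _ => //; first exact: prod_gt0.
  apply: HC => // i; first exact: ltW.
  by have [_] := hc i; apply.
- move=> dd.
  have /choice[d hd] : forall i, exists d, 0 < d /\ forall r, 0 < r <= 1 ->
      ((d * scale x r `^ (q i - a i))%:E <=
        H_factor m delta (p i) (b i) (v i) x (eucl_ball x r))%E.
    move=> i; have [d ? ?] := H_factor_scale m delta n_gt0 (b i) (p_ge1 i) mE k0 t0 (v_le i) E_ge.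
    by exists d.
  have d0 i : 0 < d i by have [] := hd i.
  have [|r r01 hr] := scale_powR_small n_gt0 x (C / \prod_i d i + 1)
      (e := (delta - delta') + \sum_i (q i - a i)); first by lra.
  have /andP[r0 _] := r01; have z0 := scale_gt0 n_gt0 x r0.
  apply: (absurd (\prod_i d i)) hr _; first exact: prod_gt0.
  rewrite powRD ?(gt_eqF z0) ?implybT// -mulrA -powR_sum// -big_split/=.
  apply: HC => // i; first by rewrite mulr_ge0 ?powR_ge0// ltW.
  by rewrite mulrC; have [_] := hd i; apply.
- move=> [dd [i0 hi0]].
  have [r r01 hr] := H_factor_unbounded n_gt0 (p_ge1 i0) mE k0 t0 (v_le i0) E_ge hi0
    (Num.max 0 (C / (\prod_(i < m | i != i0) c i) + 1)).
  have /andP[r0 _] := r01.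
  have P0 : 0 < \prod_(i < m | i != i0) c i by apply: prodr_gt0.
  apply: (absurd _ _ P0 (lexx _)).
  set M := Num.max _ _ in hr; apply: (@le_trans _ _ (M * \prod_(i < m | i != i0) c i)).
    by rewrite ler_wpM2r ?(ltW P0)// /M le_max lexx orbT.
  (* The unbounded factor is tested with [M], the others with their constants; the power of the
     scale is 1 because delta' = delta. *)
  have := HC r (fun i => if i == i0 then M else c i) r0.
  rewrite dd subrr powRr0 mul1r (bigD1 i0)//= eqxx.
  rewrite (eq_bigr c); last by move=> i /negbTE ->.
  apply=> i; first by case: ifP => _; rewrite ?(ltW (c0 i))// /M le_max lexx.
  case: eqP => [->//|_].
  by have [_] := hc i; apply.
- move=> dd.
  have /choice[d hd] : forall i, exists d, 0 < d /\ forall r, 1 <= r ->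
      ((d * scale x r `^ (- a i))%:E <=
        H_factor m delta (p i) (b i) (v i) x (eucl_ball x r))%E.
    move=> i; have [d ? ?] := H_factor_far m delta n_gt0 (b i) (p_ge1 i) mE k0 t0 (v_le i) E_ge.
    by exists d.
  have d0 i : 0 < d i by have [] := hd i.
  have [|r r1 hr] := scale_powR_large n_gt0 x (C / \prod_i d i + 1)
      (e := (delta - delta') + \sum_i (- a i)); first by rewrite sumrN; lra.
  have r0 : 0 < r by exact: lt_le_trans r1.
  have z0 := scale_gt0 n_gt0 x r0.
  apply: (absurd (\prod_i d i)) hr _; first exact: prod_gt0.
  rewrite powRD ?(gt_eqF z0) ?implybT// -mulrA -powR_sum// -big_split/=.
  apply: HC => // i; first by rewrite mulr_ge0 ?powR_ge0// ltW.
  by rewrite mulrC; have [_] := hd i; apply.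
Qed.

End no_weights.

(** * Degenerate entries and the theorem *)

(** If v_i = +oo a.e., the i-th factor is 0; if w = 0 a.e., the norm of w is. Since 0 * +oo = 0, the
    whole left-hand side vanishes even when other factors are infinite. *)
Lemma H_class_degenerate (R : realType) (m n : nat) (delta delta' : R)
    (b : 'I_m -> R) (p : 'I_m -> \bar R) (w : euclid R n -> \bar R)
    (v : 'I_m -> euclid R n -> \bar R) : (forall i, (1 <= p i)%E) ->
  (exists i, {ae lebesgue_n R n, forall x, v i x = +oo%E}) \/
    {ae lebesgue_n R n, forall x, w x = 0%E} ->
  H_class delta p b delta' w v.
Proof.
move=> p1 deg; exists 1 => //= x r r0.
have [[i vi]|w0] := deg.
  rewrite (prode_eq0 (i := i)) ?mule0 ?lee01//; apply: Lnorm_ae0.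
    exact: hoelder_conj_ge1.
  by apply: filterS vi => y ->; rewrite invey mul0e.
rewrite [Lnorm _ _ _]Lnorm_ae0 ?mul0e ?lee01 ?leey//.
by apply: filterS w0 => y ->; rewrite mul0e.
Qed.

(** Turns the threshold beta - n/p into a real number, also for p = +oo, so that the exponents can
    be compared in R. *)
Lemma sub_div_exponentE (R : realType) (m : nat) (p_ : 'I_m -> \bar R)
    (hp_ : forall i, (1 <= p_ i)%E) (p : \bar R) (beta : R) (n : nat)
    (hp : (p^-1 = \sum_(i < m) (p_ i)^-1)%E) :
  (beta%:E - n%:R%:E / p)%E = (beta - n%:R * \sum_(i < m) fine (p_ i)^-1)%:E.
Proof.
rewrite hp; under eq_bigr => i _ do rewrite inve_fineK//.
by rewrite sumEFin.
Qed.

Theorem theorem6p5 (R : realType) (m n : nat) (hm : (0 < m)%N) (hn : (0 < n)%N)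
    (delta beta delta' : R) (hbeta : 0 < beta < m%:R * n%:R)
    (b : 'I_m -> R) (hb : forall i, 0 < b i < n%:R)
    (hbsum : \sum_(i < m) b i = beta)
    (p_ : 'I_m -> \bar R) (hp_ : forall i, (1 <= p_ i)%E)
    (p : \bar R) (hp0 : (0 < p)%E) (hp : (p^-1 = \sum_(i < m) (p_ i)^-1)%E)
    (w : euclid R n -> \bar R) (v : 'I_m -> euclid R n -> \bar R)
    (hw : weight w \/ degenerate_weight 0%E w)
    (hv : forall i, weight (v i) \/ degenerate_weight +oo%E (v i)) :
  [/\ weight w ->
      delta < delta' \/ (beta%:E - n%:R%:E / p < delta'%:E)%E ->
      (H_class delta p_ b delta' w v <->
       exists i, {ae lebesgue_n R n, forall x, v i x = +oo%E}),
      weight w ->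
      delta'%:E = (beta%:E - n%:R%:E / p)%E ->
      (beta%:E - n%:R%:E / p)%E = delta%:E ->
      (* Otherwise every factor is ||1/v_i||_oo, and w = v_1 = ... = v_m = 1
         satisfies the condition. *)
      (exists i, p_ i != 1%E \/ n%:R - b i + delta / m%:R != 0) ->
      (H_class delta p_ b delta' w v <->
       exists i, {ae lebesgue_n R n, forall x, v i x = +oo%E})
    & delta' < beta - m%:R * n%:R ->
      (H_class delta p_ b delta' w v <->
       (exists i, {ae lebesgue_n R n, forall x, v i x = +oo%E}) \/
       {ae lebesgue_n R n, forall x, w x = 0%E})].
Proof.
have vP : (exists i, {ae lebesgue_n R n, forall x, v i x = +oo%E}) \/
    (forall i, weight (v i)).
  have [[i [_ _ vi]]|nv] := pselect (exists i, degenerate_weight +oo%E (v i)).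
    by left; exists i.
  by right => i; case: (hv i) => // vi; case: nv; exists i.
set a := fun i => n%:R - b i + delta / m%:R.
set q := fun i => n%:R * (1 - fine (p_ i)^-1).
set s := \sum_(i < m) fine (p_ i)^-1.
have suma : \sum_i a i = m%:R * n%:R - beta + delta.
  rewrite /a big_split/= sumrB hbsum !sumr_const card_ord.
  rewrite -[n%:R *+ m]mulr_natl -[(delta / _) *+ m]mulr_natl.
  by rewrite mulrCA mulfV ?mulr1// pnatr_eq0 -lt0n.
have sumq : \sum_i (q i - a i) = beta - n%:R * s - delta.
  rewrite sumrB suma /q -mulr_sumr sumrB sumr_const card_ord -/s.
  ring.
have := sub_div_exponentE hp_ beta n hp; rewrite -/s => ->.
split.
- move=> ww c; split => [H|?]; last by apply: H_class_degenerate => //; left.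
  case: vP => // vw; exfalso; apply: (not_H_class hn hp_ ww vw _ H).
  case: c => [c|]; first by constructor 1.
  by rewrite lte_fin => c; constructor 2; rewrite sumq; lra.
- move=> ww [c1] [c2] [i hi]; split => [H|?]; last by apply: H_class_degenerate => //; left.
  case: vP => // vw; exfalso; apply: (not_H_class hn hp_ ww vw _ H).
  constructor 3; split; first by rewrite c1 c2.
  have sum0 : \sum_i (q i - a i) = 0 by rewrite sumq c2 subrr.
  have [[j ej]|neg] := pselect (exists j, q j - a j < 0); first by exists j; left.
  have e0 j : 0 <= q j - a j by rewrite leNgt; apply/negP => ej; apply: neg; exists j.
  (* Nonnegative terms with sum 0 all vanish, in particular at the index given by the hypothesis. *)
  have aq : a i = q i.
    apply/eqP; rewrite eq_sym -subr_eq0; apply/eqP.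
    have /eqP := sum0; rewrite psumr_eq0 => [/allP/(_ i)|j _]; last exact: e0.
    by rewrite mem_index_enum => /(_ isT)/eqP.
  (* If p_i were 1, then q_i = 0 and hence a_i = 0, so the second option of the hypothesis also
     yields p_i <> 1. *)
  exists i; right; split => //; case: hi => // an0.
  apply/eqP => pi1; move: an0; rewrite -/(a i) aq /q pi1 inve1 /= subrr mulr0.
  by rewrite eqxx.
- move=> c; split => [H|?]; last exact: H_class_degenerate.
  case: hw => [ww|[_ _ w0]]; last by right.
  case: vP => [|vw]; first by left.
  exfalso; apply: (not_H_class hn hp_ ww vw _ H).
  by constructor 4; rewrite suma; lra.
Qed.
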